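(* Let $n\ge 2$, let $X_1,\dots,X_n$ be complex Banach spaces, and let $D_1\in\mathcal{B}(X_1),\ D_2\in\mathcal{B}(X_2),\dots,D_n\in\mathcal{B}(X_n)$. Assume that $D_s$ is regular for every $2\le s\le n-1$. Consider the following statements: (i) (a) $D_n\in\mathcal{G}_r(X_n)$; and (b) $D_1$ is regular and $\mathcal{K}(D_i)\preceq\mathcal{N}(D_{i+1})$ for every $1\le i\le n-1$; (ii) there exists $A\in\mathcal{B}_n$ such that $T_n^d(A)\in\mathcal{G}_r(X_1\oplus\cdots\oplus X_n)$; (iii) (a) $D_n\in\mathcal{G}_r(X_n)$; and (b) for every $1\le i\le n-1$, the relation $\bigoplus_{s=i+1}^{n}\mathcal{N}(D_s)\prec\mathcal{K}(D_i)$ does not hold. Then (i) implies (ii). If moreover $X_1,\dots,X_n$ are infinite dimensional Hilbert spaces, then (ii) implies (iii).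
   Context: For Banach spaces $X,Y$, $\mathcal{B}(X,Y)$ is the set of bounded linear operators from $X$ to $Y$, and $\mathcal{B}(X)=\mathcal{B}(X,X)$. $\mathcal{N}(T)$ and $\mathcal{R}(T)$ denote the kernel and the range of $T$. No separability is assumed. Given $D_i\in\mathcal{B}(X_i)$, $1\le i\le n$, let $\mathcal{B}_n$ be the set of all tuples $A=(A_{ij})_{1\le i<j\le n}$ with $A_{ij}\in\mathcal{B}(X_j,X_i)$. For $A\in\mathcal{B}_n$, $T_n^d(A)\in\mathcal{B}(X_1\oplus\cdots\oplus X_n)$ is the upper triangular $n\times n$ operator matrix with diagonal entries $D_1,\dots,D_n$, with $(i,j)$ entry $A_{ij}$ for $i<j$, and with $(i,j)$ entry $0$ for $i>j$. An operator $T\in\mathcal{B}(X,Y)$ is left (right) invertible if $ST=I$ ($TS=I$) for some $S\in\mathcal{B}(Y,X)$. $\mathcal{G}_r(X)$ is the set of right invertible operators in $\mathcal{B}(X)$. $T\in\mathcal{B}(X)$ is (inner) regular if $T=T\widetilde{T}T$ for some $\widetilde{T}\in\mathcal{B}(X)$; equivalently, $\mathcal{N}(T)$ and $\mathcal{R}(T)$ are closed and complemented subspaces of $X$. For $T\in\mathcal{B}(X)$ such that $\overline{\mathcal{R}(T)}$ is complemented in $X$, $\mathcal{K}(T)$ denotes a topological complement of $\overline{\mathcal{R}(T)}$ in $X$ (unique up to isomorphism; in a Hilbert space one may take $\mathcal{R}(T)^\perp$). For Banach spaces $X,Y$, write $X\preceq Y$ if there is a left invertible operator from $X$ to $Y$.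 Write $X\prec Y$ if $X\preceq Y$ and $Y/\mathcal{R}(T)$ is an infinite dimensional linear space for every $T\in\mathcal{B}(X,Y)$. (If $X,Y$ are Hilbert spaces, then $X\preceq Y$ iff $\dim X\le\dim Y$, and $X\prec Y$ iff $\dim X<\dim Y$ and $\dim Y=\infty$, where $\dim$ is the orthogonal dimension.) *)

(* Defs.v *)
From HB Require Import structures.
From mathcomp Require Import all_boot all_order all_algebra.
From mathcomp Require Import sesquilinear.
From mathcomp Require Export complex.
From mathcomp Require Import all_classical all_reals all_analysis.

Set Implicit Arguments.
Unset Strict Implicit.
Unset Printing Implicit Defensive.

Import Order.TTheory GRing.Theory Num.Theory.
Import numFieldNormedType.Exports.

Local Open Scope classical_set_scope.
Local Open Scope ring_scope.

Record bounded_op (K : numFieldType) (X Y : normedModType K) := BoundedOp {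
  op :> {linear X -> Y};
  opP : exists M : K, forall x, `|op x| <= M * `|x| }.

Notation "''B' ( X , Y )" := (bounded_op X Y)
  (at level 8, X at level 99, Y at level 99, format "''B' ( X ,  Y )").

Section bounded_op_theory.
Context {K : numFieldType} {X Y : normedModType K}.
Implicit Types T : 'B(X, Y).

Lemma op_bound_gt0 T : exists2 M : K, 0 < M & forall x, `|T x| <= M * `|x|.
Proof.
have [M TM] := opP T.
have [[x x0]|/forallNP all0] := pselect (exists x : X, x != 0).
  have M0 : 0 <= M.
    by rewrite -(pmulr_lge0 _ (_ : 0 < `|x|)) ?normr_gt0// (le_trans _ (TM x)).
  exists (M + 1); first by rewrite ltr_wpDl.
  by move=> y; rewrite mulrDl mul1r (le_trans (TM y))// lerDl.
exists 1 => // x; have /negP/negPn/eqP -> := all0 x.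
by rewrite linear0 !normr0 mulr0.
Qed.

Lemma op_continuous T : continuous T.
Proof.
apply/linear_bounded_continuous/linear_boundedP.
have [M M0 TM] := op_bound_gt0 T.
near=> r => x; rewrite (le_trans (TM x))// ler_wpM2r//.
by near: r; apply: nbhs_pinfty_ge; rewrite gtr0_real.
Unshelve. all: by end_near. Qed.

End bounded_op_theory.

Definition right_invertible (K : numFieldType) (X Y : normedModType K)
    (T : 'B(X, Y)) :=
  exists S : 'B(Y, X), forall y, T (S y) = y.

Definition left_invertible (K : numFieldType) (X Y : normedModType K)
    (T : 'B(X, Y)) :=
  exists S : 'B(Y, X), forall x, S (T x) = x.

Definition regular (K : numFieldType) (X : normedModType K) (T : 'B(X, X)) :=
  exists T' : 'B(X, X), forall x, T x = T (T' (T x)).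

(* For a linear subspace U of Y: the quotient Y / U is spanned by the classes
   of finitely many vectors of Y. *)
Definition finite_dim_quotient (K : numFieldType) (Y : lmodType K)
    (U : set Y) :=
  exists s : seq Y, forall y, exists2 u, U u &
    exists c : 'I_(size s) -> K, y = u + \sum_i c i *: s`_i.

Definition infinite_dim (K : numFieldType) (X : lmodType K) :=
  ~ finite_dim_quotient [set 0 : X].

Definition preceq (K : numFieldType) (X Y : completeNormedModType K) :=
  exists J : 'B(X, Y), left_invertible J.

Definition prec (K : numFieldType) (X Y : completeNormedModType K) :=
  preceq X Y /\ forall T : 'B(X, Y), ~ finite_dim_quotient (range T).

(* A Banach space is a Hilbert space when its norm comes from an inner product
   (linear in the first argument, conjugate-linear in the second). *)
Definition hilbert (C : numClosedFieldType) (X : completeNormedModType C) :=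
  exists ip : {dot X for Num.conj}, forall x : X, `|x| ^+ 2 = ip x x.

Record closed_subspace (K : numFieldType) (X : completeNormedModType K) :=
  ClosedSubspace {
    carrier :> set X;
    carrier_closed : closed carrier;
    carrier0 : carrier 0;
    carrier_lin : forall (a : K) x y,
      carrier x -> carrier y -> carrier (a *: x + y) }.

Section subspace_banach.
Context {K : numFieldType} {X : completeNormedModType K}.
Variable U : closed_subspace X.

Definition subspace_pred : {pred X} := fun x => `[< carrier U x >].

Definition subspace_type := {x : X | subspace_pred x}.

HB.instance Definition _ := SubChoice.on subspace_type.

Lemma subspace_predE x : (x \in subspace_pred) = `[< carrier U x >].
Proof. by []. Qed.

Lemma subspace_pred_closed : subsemimod_closed subspace_pred.
Proof.
split; first split.
- by apply/asboolP/carrier0.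
- move=> x y /asboolP Ux /asboolP Uy; apply/asboolP.
  by rewrite -[x]scale1r; exact: carrier_lin.
- move=> a x /asboolP Ux; apply/asboolP.
  by rewrite -[_ *: _]addr0; apply: carrier_lin => //; exact: carrier0.
Qed.

HB.instance Definition _ := GRing.SubChoice_isSubLmodule.Build
  K X subspace_pred subspace_type subspace_pred_closed.

Let nrm (x : subspace_type) : K := `|val x|.

Let nrmD x y : nrm (x + y) <= nrm x + nrm y.
Proof. by rewrite /nrm raddfD ler_normD. Qed.

Let nrmZ (l : K) x : nrm (l *: x) = `|l| * nrm x.
Proof. by rewrite /nrm linearZ normrZ. Qed.

Let nrm0 x : nrm x = 0 -> x = 0.
Proof. by move/normr0_eq0 => x0; apply: val_inj; rewrite x0 raddf0. Qed.

HB.instance Definition _ :=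
  Lmodule_isNormed.Build K subspace_type nrmD nrmZ nrm0.

Lemma subspace_normE (x : subspace_type) : `|x| = `|val x|.
Proof. by []. Qed.

Let complete_subspace (F : set_system subspace_type) :
  ProperFilter F -> cauchy F -> cvg F.
Proof.
move=> FF cF.
have cG : cauchy (val @ F : set_system X).
  apply/cauchy_ballP => e e0.
  have /cauchy_ballP /(_ _ e0) := cF.
  rewrite /prop_near2 /= => -[[A B] /= [FA FB] AB].
  exists (val @` A, val @` B) => /=.
    split; first by apply: filterS FA => x Ax; exists x.
    by apply: filterS FB => x Bx; exists x.
  move=> [_ _] /= [[x Ax <-] [y By <-]].
  have := AB (x, y) (conj Ax By).
  by rewrite -!ball_normE /= /ball_ /= subspace_normE raddfB.
have /cvg_ex[/= l vl] : cvg (val @ F : set_system X) by exact: cauchy_cvg.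
have Ul : carrier U l.
  apply: (closed_cvg (carrier U) _ _ _ vl) => //; first exact: carrier_closed.
  by apply: nearW => x; apply/asboolP; exact: (valP x).
have Pl : subspace_pred l by apply/asboolP.
apply/cvg_ex; exists (Sub l Pl : subspace_type).
apply/cvgrPdist_lt => e e0.
move/cvgrPdist_lt : vl => /(_ e e0); apply: filterS => x /=.
by rewrite subspace_normE raddfB.
Qed.

HB.instance Definition _ :=
  Uniform_isComplete.Build subspace_type complete_subspace.

Definition subspace_banach : completeNormedModType K := subspace_type.

End subspace_banach.

Coercion subspace_banach : closed_subspace >-> CompleteNormedModule.type.

Section nullspace.
Context {K : numFieldType} {X Y : completeNormedModType K}.
Variable T : 'B(X, Y).

Let ker : set X := [set x | T x = 0].

Let ker_closed : closed ker.
Proof.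
apply: (@closed_comp _ _ T [set 0]) => [x _|]; first exact: op_continuous.
exact/accessible_closed_set1/hausdorff_accessible/norm_hausdorff.
Qed.

Let ker0 : ker 0. Proof. exact: linear0. Qed.

Let ker_lin (a : K) x y : ker x -> ker y -> ker (a *: x + y).
Proof. by rewrite /ker /= linearP => -> ->; rewrite scaler0 addr0. Qed.

Definition nullspace : closed_subspace X :=
  ClosedSubspace ker_closed ker0 ker_lin.

End nullspace.

(* X is the topological direct sum of U and V: P is the continuous projection
   onto V along U. *)
Definition topological_complement (K : numFieldType)
    (X : completeNormedModType K) (U V : set X) :=
  exists P : 'B(X, X),
    [/\ forall x, V (P x), forall x, U (x - P x),
        forall x, V x -> P x = x & forall x, U x -> P x = 0].

Definition complemented (K : numFieldType) (X : completeNormedModType K)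
    (U : set X) :=
  exists V : closed_subspace X, topological_complement U V.

Definition dsum_type (K : numFieldType) (I : finType)
  (X : I -> completeNormedModType K) := forall i, X i.

Section dsum.
Context {K : numFieldType} {I : finType}.
Variable X : I -> completeNormedModType K.

HB.instance Definition _ := gen_eqMixin (dsum_type X).
HB.instance Definition _ := gen_choiceMixin (dsum_type X).

Implicit Types x y z : dsum_type X.

Let add x y : dsum_type X := fun i => x i + y i.
Let opp x : dsum_type X := fun i => - x i.
Let zero : dsum_type X := fun i => 0.
Let scale (a : K) x : dsum_type X := fun i => a *: x i.

Let addA : associative add.
Proof. by move=> x y z; apply/functional_extensionality_dep => i; exact: addrA. Qed.
Let addC : commutative add.
Proof. by move=> x y; apply/functional_extensionality_dep => i; exact: addrC. Qed.
Let add0 : left_id zero add.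
Proof. by move=> x; apply/functional_extensionality_dep => i; exact: add0r. Qed.
Let addN : left_inverse zero opp add.
Proof. by move=> x; apply/functional_extensionality_dep => i; exact: addNr. Qed.

HB.instance Definition _ :=
  GRing.isZmodule.Build (dsum_type X) addA addC add0 addN.

Let scaleA (a b : K) x : scale a (scale b x) = scale (a * b) x.
Proof. by apply/functional_extensionality_dep => i; exact: scalerA. Qed.
Let scale1 : left_id 1 scale.
Proof. by move=> x; apply/functional_extensionality_dep => i; exact: scale1r. Qed.
Let scaleDr : right_distributive scale +%R.
Proof. by move=> a x y; apply/functional_extensionality_dep => i; exact: scalerDr. Qed.
Let scaleDl x : {morph scale^~ x : a b / a + b}.
Proof. by move=> a b; apply/functional_extensionality_dep => i; exact: scalerDl. Qed.

HB.instance Definition _ := GRing.Zmodule_isLmodule.Build K (dsum_type X)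
  scaleA scale1 scaleDr scaleDl.

Lemma dsumDE x y i : (x + y) i = x i + y i. Proof. by []. Qed.
Lemma dsumNE x i : (- x) i = - x i. Proof. by []. Qed.
Lemma dsumZE (a : K) x i : (a *: x) i = a *: x i. Proof. by []. Qed.

Let nrm x : K := \sum_i `|x i|.

Let nrmD x y : nrm (x + y) <= nrm x + nrm y.
Proof. by rewrite /nrm -big_split ler_sum// => i _; exact: ler_normD. Qed.

Let nrmZ (l : K) x : nrm (l *: x) = `|l| * nrm x.
Proof. by rewrite /nrm mulr_sumr; apply: eq_bigr => i _; exact: normrZ. Qed.

Let nrm0 x : nrm x = 0 -> x = 0.
Proof.
move=> /eqP; rewrite psumr_eq0 => [/allP x0|i _]; last exact: normr_ge0.
apply/functional_extensionality_dep => i; apply/eqP.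
by rewrite -normr_eq0; apply: x0; rewrite mem_index_enum.
Qed.

(* The l^1 norm: as I is finite, it induces the product topology, like every
   other usual norm of a direct sum, and none of the notions of this file
   depends on the choice among equivalent norms, [hilbert] excepted. *)
HB.instance Definition _ :=
  Lmodule_isNormed.Build K (dsum_type X) nrmD nrmZ nrm0.

Lemma dsum_normE x : `|x| = \sum_i `|x i|.
Proof. by []. Qed.

Lemma dsum_norm_ge x i : `|x i| <= `|x|.
Proof. by rewrite dsum_normE (bigD1 i)//= lerDl sumr_ge0. Qed.

Let complete_dsum (F : set_system (dsum_type X)) :
  ProperFilter F -> cauchy F -> cvg F.
Proof.
move=> FF cF.
have cG i : cauchy ((fun x : dsum_type X => x i) @ F : set_system (X i)).
  apply/cauchy_ballP => e e0.
  have /cauchy_ballP /(_ _ e0) := cF.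
  rewrite /prop_near2 /= => -[[A B] /= [FA FB] AB].
  exists ((fun x : dsum_type X => x i) @` A, (fun x : dsum_type X => x i) @` B) => /=.
    split; first by apply: filterS FA => x Ax; exists x.
    by apply: filterS FB => x Bx; exists x.
  move=> [_ _] /= [[x Ax <-] [y By <-]].
  have := AB (x, y) (conj Ax By).
  rewrite -!ball_normE /= /ball_ /=; apply: le_lt_trans.
  exact: (dsum_norm_ge (x - y) i).
have cvF i : exists l : X i, (fun x : dsum_type X => x i) @ F --> l.
  apply/(cvg_ex ((fun x : dsum_type X => x i) @ F : set_system (X i))).
  exact: (@cauchy_cvg (X i) _ (fmap_proper_filter _ FF) (cG i)).
pose l : dsum_type X := fun i => sval (cid (cvF i)).
have lP i : (fun x : dsum_type X => x i) @ F --> l i by exact: svalP (cid (cvF i)).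
apply/cvg_ex; exists l; apply/cvgrPdist_lt => e e0.
pose d := e / #|I|.+1%:R.
have d0 : 0 < d by rewrite divr_gt0.
have : \forall x \near F, forall i, `|l i - x i| < d.
  by apply: filter_forall => i; move/cvgrPdist_lt : (lP i) => /(_ d d0).
apply: filterS => x lx; rewrite dsum_normE.
apply: (@le_lt_trans _ _ (\sum_(i in I) d)).
  by apply: ler_sum => i _; exact/ltW/lx.
rewrite sumr_const /d -[X in X < _]mulr_natr mulrAC ltr_pdivrMr//.
by rewrite ltr_pM2l// ltr_nat.
Qed.

HB.instance Definition _ :=
  Uniform_isComplete.Build (dsum_type X) complete_dsum.

Definition dsum : completeNormedModType K := dsum_type X.

End dsum.

Section triangular_operator.
Context {K : numFieldType} {n : nat} {X : 'I_n -> completeNormedModType K}.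
Variables (D : forall i, 'B(X i, X i)) (A : forall i j : 'I_n, 'B(X j, X i)).

Definition triangular_fun (x : dsum X) : dsum X :=
  fun i => D i (x i) + \sum_(j < n | (i < j)%N) A i j (x j).

Let triangular_linear : linear triangular_fun.
Proof.
move=> a x y; apply/functional_extensionality_dep => i.
rewrite /triangular_fun dsumDE dsumZE linearP.
under eq_bigr do rewrite dsumDE dsumZE linearP.
by rewrite big_split/= -scaler_sumr addrACA -scalerDr.
Qed.

HB.instance Definition _ := GRing.isLinear.Build K (dsum X) (dsum X) _
  triangular_fun triangular_linear.

Let triangular_bounded :
  exists M : K, forall x, `|triangular_fun x| <= M * `|x|.
Proof.
have /choice[MD MDP] i : exists M : K, 0 < M /\ forall x, `|D i x| <= M * `|x|.
  by have [M] := op_bound_gt0 (D i); exists M.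
have /choice[MA MAP] (ij : 'I_n * 'I_n) :
    exists M : K, 0 < M /\ forall x, `|A ij.1 ij.2 x| <= M * `|x|.
  by have [M] := op_bound_gt0 (A ij.1 ij.2); exists M.
exists (\sum_i (MD i + \sum_(j < n | (i < j)%N) MA (i, j))) => x.
rewrite mulr_suml dsum_normE; apply: ler_sum => i _.
rewrite (le_trans (ler_normD _ _))// mulrDl lerD//.
  rewrite (le_trans ((MDP i).2 _))// ler_wpM2l ?(ltW (MDP i).1)//.
  exact: (dsum_norm_ge (x : dsum_type X) i).
rewrite (le_trans (ler_norm_sum _ _ _))// mulr_suml; apply: ler_sum => j _.
rewrite (le_trans ((MAP (i, j)).2 _))// ler_wpM2l ?(ltW (MAP (i, j)).1)//.
exact: (dsum_norm_ge (x : dsum_type X) j).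
Qed.

(* Only the entries A i j with i < j matter, so a total family A stands for the
   tuple of the entries above the diagonal. *)
Definition triangular_op : 'B(dsum X, dsum X) :=
  @BoundedOp _ _ _ triangular_fun triangular_bounded.

End triangular_operator.

(* Main.v *)
(* (i) => (ii): let J_i embed K_i into N(D_{i+1}) with left inverse S_i. Put
   A_{i,i+1} = S_i P, with P the projection of X_{i+1} onto N(D_{i+1}), and let
   all the other entries vanish. In row i, D_i reaches the component of y_i in
   R(D_i), and the component of y_i in K_i is reached through A_{i,i+1} by its
   image under J_i, which D_{i+1} annihilates.

   (ii) => (iii): any y_i in X_i is the i-th row of some x that is annihilated
   by the rows below. By regularity, back substitution is a bounded operator G
   recovering (x_s)_{s > i} from its components in the kernels N(D_s), so that
   K_i is the range of Q_i (\sum_{j > i} A_ij) G, where Q_i is the projection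
   onto K_i along the closure of R(D_i). The Hilbert structure serves only to
   complement that closure for i = 1, where D_1 need not be regular. *)

Require Import Defs.
From HB Require Import structures.
From mathcomp Require Import all_boot all_order all_algebra.
From mathcomp Require Import sesquilinear.
From mathcomp Require Import all_classical all_reals all_analysis.
From mathcomp Require Import ring lra.

Set Implicit Arguments.
Unset Strict Implicit.
Unset Printing Implicit Defensive.

Import Order.TTheory GRing.Theory Num.Theory.
Import numFieldNormedType.Exports.

Local Open Scope classical_set_scope.
Local Open Scope ring_scope.

(** * Bounded operators on subspaces and direct sums *)

Section bounded_op_constructions.
Context {K : numFieldType}.
Implicit Types X Y Z : normedModType K.

Lemma zero_op_bounded X Y :
  exists M : K, forall x : X, `|(\0 : X -> Y) x| <= M * `|x|.
Proof. by exists 0 => x; rewrite normr0 mul0r. Qed.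

Definition zero_op X Y : 'B(X, Y) := BoundedOp (zero_op_bounded X Y).

Lemma id_op_bounded X :
  exists M : K, forall x : X, `|(idfun : X -> X) x| <= M * `|x|.
Proof. by exists 1 => x; rewrite mul1r. Qed.

Definition id_op X : 'B(X, X) := BoundedOp (id_op_bounded X).

Lemma comp_op_bounded X Y Z (S : 'B(Y, Z)) (T : 'B(X, Y)) :
  exists M : K, forall x, `|(S \o T) x| <= M * `|x|.
Proof.
have [M M0 SM] := op_bound_gt0 S; have [N _ TN] := op_bound_gt0 T.
by exists (M * N) => x; rewrite (le_trans (SM _))// -mulrA ler_pM2l.
Qed.

Definition comp_op X Y Z (S : 'B(Y, Z)) (T : 'B(X, Y)) : 'B(X, Z) :=
  BoundedOp (comp_op_bounded S T).

Lemma add_op_bounded X Y (S T : 'B(X, Y)) :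
  exists M : K, forall x, `|(S \+ T) x| <= M * `|x|.
Proof.
have [M _ SM] := op_bound_gt0 S; have [N _ TN] := op_bound_gt0 T.
by exists (M + N) => x; rewrite mulrDl (le_trans (ler_normD _ _))// lerD.
Qed.

Definition add_op X Y (S T : 'B(X, Y)) : 'B(X, Y) :=
  BoundedOp (add_op_bounded S T).

Lemma sub_op_bounded X Y (S T : 'B(X, Y)) :
  exists M : K, forall x, `|(S \- T) x| <= M * `|x|.
Proof.
have [M _ SM] := op_bound_gt0 S; have [N _ TN] := op_bound_gt0 T.
by exists (M + N) => x; rewrite mulrDl (le_trans (ler_normB _ _))// lerD.
Qed.

Definition sub_op X Y (S T : 'B(X, Y)) : 'B(X, Y) :=
  BoundedOp (sub_op_bounded S T).

End bounded_op_constructions.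

Section subspace_operators.
Context {K : numFieldType} {X : completeNormedModType K}.
Variable U : closed_subspace X.

Lemma subspace_valP (u : subspace_type U) : carrier U (val u).
Proof. exact/asboolP/(valP u). Qed.

Definition subspace_incl (u : subspace_type U) : X := \val u.

Lemma subspace_incl_linear : linear subspace_incl.
Proof. by move=> a u v; rewrite /subspace_incl linearP. Qed.

HB.instance Definition _ :=
  GRing.isLinear.Build K (subspace_type U) X _
  subspace_incl subspace_incl_linear.

Lemma incl_op_bounded : exists M : K, forall u, `|subspace_incl u| <= M * `|u|.
Proof. by exists 1 => u; rewrite mul1r. Qed.

Definition incl_op : 'B(U, X) := BoundedOp incl_op_bounded.

Context {Y : normedModType K}.
Variables (T : 'B(Y, X)) (TU : forall y, carrier U (T y)).

Definition corestrict (y : Y) : subspace_type U :=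
  Sub (T y) (asboolT (TU y)).

Lemma corestrict_linear : linear corestrict.
Proof. by move=> a x y; apply: val_inj; rewrite /= linearP. Qed.

HB.instance Definition _ :=
  GRing.isLinear.Build K Y (subspace_type U) _ corestrict corestrict_linear.

Lemma corestrict_bounded :
  exists M : K, forall y, `|corestrict y| <= M * `|y|.
Proof. exact: (opP T). Qed.

Definition corestrict_op : 'B(Y, U) := BoundedOp corestrict_bounded.

End subspace_operators.

Section dsum_operators.
Context {K : numFieldType} {I : finType} {X : I -> completeNormedModType K}.

Section coordinate.
Variable i : I.

Definition dsum_proj (x : dsum X) : X i := x i.

Lemma dsum_proj_linear : linear dsum_proj. Proof. by []. Qed.

HB.instance Definition _ :=
  GRing.isLinear.Build K (dsum X) (X i) _ dsum_proj dsum_proj_linear.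

Lemma dsum_proj_bounded : exists M : K, forall x, `|dsum_proj x| <= M * `|x|.
Proof.
by exists 1 => x; rewrite mul1r; exact: (dsum_norm_ge (x : dsum_type X)).
Qed.

Definition dsum_proj_op : 'B(dsum X, X i) := BoundedOp dsum_proj_bounded.

End coordinate.

Section into.
Context {Y : normedModType K}.
Variable F : forall i, 'B(Y, X i).

Definition dsum_pair (y : Y) : dsum X := fun i => F i y.

Lemma dsum_pair_linear : linear dsum_pair.
Proof.
by move=> a x y; apply/functional_extensionality_dep => i; exact: linearP.
Qed.

HB.instance Definition _ :=
  GRing.isLinear.Build K Y (dsum X) _ dsum_pair dsum_pair_linear.

Lemma dsum_pair_bounded : exists M : K, forall y, `|dsum_pair y| <= M * `|y|.
Proof.
have /choice[M MP] i := opP (F i).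
exists (\sum_i M i) => y; rewrite dsum_normE mulr_suml.
by apply: ler_sum => i _; exact: MP.
Qed.

Definition dsum_pair_op : 'B(Y, dsum X) := BoundedOp dsum_pair_bounded.

End into.

Section out_of.
Context {Y : normedModType K}.
Variable F : forall i, 'B(X i, Y).

Definition dsum_copair (x : dsum X) : Y := \sum_i F i (x i).

Lemma dsum_copair_linear : linear dsum_copair.
Proof.
move=> a x y; rewrite /dsum_copair scaler_sumr -big_split/=.
by apply: eq_bigr => i _; exact: linearP.
Qed.

HB.instance Definition _ :=
  GRing.isLinear.Build K (dsum X) Y _ dsum_copair dsum_copair_linear.

Lemma dsum_copair_bounded :
  exists M : K, forall x, `|dsum_copair x| <= M * `|x|.
Proof.
have /choice[M MP] i : exists M : K, 0 < M /\ forall x, `|F i x| <= M * `|x|.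
  by have [M] := op_bound_gt0 (F i); exists M.
exists (\sum_i M i) => x; rewrite (le_trans (ler_norm_sum _ _ _))// mulr_suml.
apply: ler_sum => i _; rewrite (le_trans ((MP i).2 _))// ler_pM2l ?(MP i).1//.
exact: (dsum_norm_ge (x : dsum_type X)).
Qed.

Definition dsum_copair_op : 'B(dsum X, Y) := BoundedOp dsum_copair_bounded.

End out_of.

(** [dfwith] overrides the zero family at [i], which avoids transporting the identity along an
    equality of indices. *)
Definition dsum_inj_op (i : I) : 'B(X i, dsum X) :=
  dsum_pair_op (dfwith (fun j => zero_op (X i) (X j)) i (id_op (X i))).

Lemma dsum_injE i (x : X i) : dsum_inj_op i x i = x.
Proof. by rewrite /= /dsum_pair dfwithin. Qed.

Lemma dsum_inj_neq i j (x : X i) : i != j -> dsum_inj_op i x j = 0.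
Proof. by move=> ij; rewrite /= /dsum_pair dfwithout. Qed.

End dsum_operators.

(** * Triangular operators *)

Section regular_operators.
Context {K : numFieldType} {X : completeNormedModType K}.
Implicit Type T : 'B(X, X).

Lemma right_invertible_regular T : right_invertible T -> regular T.
Proof. by move=> [S TS]; exists S => x; rewrite TS. Qed.

(** [T T'] is a projection onto the range of [T], so the range is the kernel of the bounded operator
    [T T' - I]. *)
Lemma regular_closed_range T : regular T -> closed (range T).
Proof.
move=> [T' TT'].
suff -> : range T = carrier (nullspace (sub_op (comp_op T T') (id_op X))).
  exact: carrier_closed.
apply/seteqP; split => [_ [x _ <-]|x] /=; first by rewrite -TT' subrr.
by move=> /eqP; rewrite subr_eq0 => /eqP <-; exists (T' x).
Qed.

Lemma regular_complemented T : regular T -> complemented (closure (range T)).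
Proof.
move=> Treg; rewrite -(proj1 (closure_id _) (regular_closed_range Treg)).
have [T' TT'] := Treg.
exists (nullspace (comp_op T T')), (sub_op (id_op X) (comp_op T T')).
split=> /=.
- by move=> x; rewrite !linearB/= -TT' subrr.
- by move=> x; exists (T' x) => //; rewrite subKr.
- by move=> x ->; rewrite subr0.
- by move=> _ [x _ <-]; rewrite -TT' subrr.
Qed.

End regular_operators.

(** [A] is [S] after the projection [I - D' D] onto the kernel of [D], and [W] is [J] after [Q]. The
    last clause says that [A] ignores the [D'] terms that a right inverse puts in the next
    coordinate. *)
Lemma kernel_transfer (K : numFieldType) (X Y : completeNormedModType K)
    (D D' : 'B(Y, Y)) (V : closed_subspace X) (Q : 'B(X, X)) :
  (forall y, D y = D (D' (D y))) -> (forall x, carrier V (Q x)) ->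
  preceq V (nullspace D) ->
  exists (A : 'B(Y, X)) (W : 'B(X, Y)),
    [/\ forall x, D (W x) = 0, forall x, A (W x) = Q x &
        forall y, A (D' (D y)) = 0].
Proof.
move=> DD' VQ [J [S SJ]].
have DN y : carrier (nullspace D) (sub_op (id_op Y) (comp_op D' D) y).
  by rewrite /= linearB/= -DD' subrr.
exists (comp_op (incl_op V) (comp_op S (corestrict_op DN))).
exists (comp_op (incl_op (nullspace D)) (comp_op J (corestrict_op VQ))).
have corN (u : subspace_type (nullspace D)) : corestrict DN (\val u) = u.
  apply: val_inj => /=.
  by rewrite [D _](@subspace_valP _ _ (nullspace D) u) linear0 subr0.
split=> [x|x|y] /=.
- exact: (@subspace_valP _ _ (nullspace D) (J (corestrict VQ x))).
- by rewrite /subspace_incl corN SJ.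
- suff -> : corestrict DN (D' (D y)) = 0 by rewrite !linear0.
  by apply: val_inj; rewrite /= -DD' subrr.
Qed.

Section triangular_operators.
Context {K : numFieldType} {n : nat} {X : 'I_n.+1 -> completeNormedModType K}.
Variable D : forall i, 'B(X i, X i).

Lemma triangular_opE (A : forall i j : 'I_n.+1, 'B(X j, X i)) x i :
  triangular_op D A x i = D i (x i) + \sum_(j < n.+1 | (i < j)%N) A i j (x j).
Proof. by []. Qed.

(** Coordinate [j] of the right inverse is [D' j (y j - Q j (y j))] plus the lift by [W] of the
    preceding [y i]. In row [i], [D i] annihilates the lift and recovers [y i - Q i (y i)], while
    the superdiagonal [A] annihilates the next [D'] term and turns the lift of [y i] into
    [Q i (y i)]. *)
Lemma superdiagonal_right_invertible (D' Q : forall i, 'B(X i, X i)) :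
  (forall i x, D i x = D i (D' i (D i x))) ->
  (forall i y, range (D i) (y - Q i y)) ->
  (forall y, Q ord_max y = 0) ->
  (forall i j : 'I_n.+1, j = i.+1 :> nat ->
    exists (A : 'B(X j, X i)) (W : 'B(X i, X j)),
      [/\ forall x, D j (W x) = 0, forall x, A (W x) = Q i x &
          forall y, A (D' j (D j y)) = 0]) ->
  exists A : forall i j : 'I_n.+1, 'B(X j, X i),
    right_invertible (triangular_op D A).
Proof.
move=> DD' DQ Qmax AW.
(* Extended by zero off the superdiagonal, the pairs [(A, W)] form total families that can be chosen
   all at once. *)
have FP0 : forall ij : 'I_n.+1 * 'I_n.+1,
    exists F : 'B(X ij.2, X ij.1) * 'B(X ij.1, X ij.2),
    [/\ forall x, D ij.2 (F.2 x) = 0,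
      forall y, F.1 (D' ij.2 (D ij.2 y)) = 0 &
      if ij.2 == ij.1.+1 :> nat then forall x, F.1 (F.2 x) = Q ij.1 x
      else (forall y, F.1 y = 0) /\ forall x, F.2 x = 0].
  case=> i j /=; case: eqP => [/AW[A [W [? ? ?]]]|_].
    by exists (A, W).
  by exists (zero_op _ _, zero_op _ _); split=> //= x; rewrite linear0.
have [F FP] := all_sig (fun ij => cid (FP0 ij)).
pose A (i j : 'I_n.+1) : 'B(X j, X i) := (F (i, j)).1.
pose W (i j : 'I_n.+1) : 'B(X i, X j) := (F (i, j)).2.
have DW i j x : D j (W i j x) = 0 by have [] := FP (i, j).
have AD' i j y : A i j (D' j (D j y)) = 0 by have [] := FP (i, j).
have AWE (i j : 'I_n.+1) x : j = i.+1 :> nat -> A i j (W i j x) = Q i x.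
  by move=> ji; have [_ _] := FP (i, j); rewrite /= ji eqxx; exact.
have A0 (i j : 'I_n.+1) y : j != i.+1 :> nat -> A i j y = 0.
  by move=> /negPf ji; have [_ _] := FP (i, j); rewrite /= ji => -[].
have W0 (i j : 'I_n.+1) x : j != i.+1 :> nat -> W i j x = 0.
  by move=> /negPf ji; have [_ _] := FP (i, j); rewrite /= ji => -[].
exists A.
pose S := dsum_pair_op (fun j => add_op
  (comp_op (comp_op (D' j) (sub_op (id_op _) (Q j))) (dsum_proj_op j))
  (dsum_copair_op (fun i => W i j))).
have SE y j : S y j = D' j (y j - Q j (y j)) + \sum_i W i j (y i) by [].
exists S => y; apply/functional_extensionality_dep => i.
rewrite triangular_opE SE linearD linear_sum.
under eq_bigr do rewrite DW.
rewrite sumr_const mul0rn addr0.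
have [z _ zE] := DQ i (y i).
rewrite -zE -DD' zE -[RHS](subrK (Q i (y i))); congr (_ + _).
(* The [D'] part of [S y j] comes from a vector in the range of [D j], so [A i j] kills it. *)
have AS j : A i j (S y j) = \sum_k A i j (W k j (y k)).
  by have [w _ wE] := DQ j (y j); rewrite SE -wE linearD AD' add0r linear_sum.
have [->|/negPf imax] := eqVneq i ord_max.
  by rewrite Qmax big1// => j; rewrite ltnNge -ltnS ltn_ord.
have Si : (i.+1 < n.+1)%N.
  rewrite ltn_neqAle ltn_ord andbT eqSS.
  by apply: contraFN imax => /eqP iE; exact/eqP/val_inj.
rewrite (bigD1 (Ordinal Si)) //= [X in _ + X]big1 ?addr0; last first.
  by move=> j /andP[_ ji]; rewrite A0//.
rewrite -[dsum_pair _ _ _]/(S y (Ordinal Si)) AS.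
rewrite (bigD1 i)//= AWE// big1 ?addr0// => k ki.
rewrite W0 ?linear0//= eqSS; apply: contra ki => /eqP ki; exact/eqP/val_inj.
Qed.

(** The last row of the matrix contains only [D ord_max]. *)
Lemma triangular_last_right_invertible (A : forall i j, 'B(X j, X i)) :
  right_invertible (triangular_op D A) -> right_invertible (D ord_max).
Proof.
move=> [S TS].
exists (comp_op (dsum_proj_op ord_max) (comp_op S (dsum_inj_op ord_max))) => y.
have := congr1 (fun x : dsum X => x ord_max) (TS (dsum_inj_op ord_max y)).
rewrite triangular_opE dsum_injE big_pred0 ?addr0// => j.
by rewrite ltnNge -ltnS ltn_ord.
Qed.

Notation tail_kernels i :=
  (dsum (fun s : {s : 'I_n.+1 | (i < s)%N} => nullspace (D (val s)))).

(* A solution x of the rows below i satisfies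
   x s = (x s - D' (D x s)) - D' (\sum_(s < j) A s j (x j)): it is recovered
   from its components in the kernels by back substitution, the k-th iterate
   being correct on the last k coordinates. *)
Lemma back_substitution (A : forall i j, 'B(X j, X i)) (i : 'I_n.+1) :
  (forall s : 'I_n.+1, (i < s)%N -> regular (D s)) ->
  exists G : 'B(tail_kernels i, dsum X), forall x : dsum X,
    (forall s : 'I_n.+1, (i < s)%N -> triangular_op D A x s = 0) ->
    exists l, forall s : 'I_n.+1, (i < s)%N -> G l s = x s.
Proof.
move=> Dreg.
have D'P (s : 'I_n.+1) : exists D' : 'B(X s, X s),
    (i < s)%N -> forall x, D s x = D s (D' (D s x)).
  have [/Dreg[D' DD']|_] := boolP (i < s)%N; first by exists D'.
  by exists (zero_op _ _).
have [D' DD'] := all_sig (fun s => cid (D'P s)).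
(* Matching on [idP] exposes the proof of [i < s] that indexes the kernel summand; the other
   coordinates are set to zero. *)
pose E : 'B(tail_kernels i, dsum X) := dsum_pair_op (fun s : 'I_n.+1 =>
  match @idP (i < s)%N return 'B(tail_kernels i, X s) with
  | ReflectT si => comp_op (incl_op (nullspace (D s)))
      (@dsum_proj_op _ _ (fun t : {t : 'I_n.+1 | (i < t)%N} =>
        nullspace (D (val t)) : completeNormedModType K) (exist _ s si))
  | ReflectF _ => zero_op _ _
  end).
(* The zero diagonal makes coordinate [s] of [N x] depend only on the coordinates beyond [s]. *)
pose N := triangular_op (fun s => zero_op (X s) (X s))
  (fun s j => comp_op (D' s) (A s j)).
have NE x s : N x s = D' s (\sum_(j < n.+1 | (s < j)%N) A s j (x j)).
  by rewrite /= /triangular_fun /= add0r linear_sum.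
pose G k := iter k (fun H : 'B(tail_kernels i, dsum X) =>
  sub_op E (comp_op N H)) (zero_op _ _).
exists (G n.+1) => x Tx.
have xN (s : 'I_n.+1) (si : (i < s)%N) :
    D s (x s) = - \sum_(j < n.+1 | (s < j)%N) A s j (x j).
  by apply/eqP; rewrite -addr_eq0; exact/eqP/Tx.
have kerP (s : {s : 'I_n.+1 | (i < s)%N}) y :
    carrier (nullspace (D (val s)))
      (sub_op (id_op _) (comp_op (D' (val s)) (D (val s))) y).
  by case: s y => s si y /=; rewrite linearB/= -DD'// subrr.
pose l : tail_kernels i := fun s => corestrict (kerP s) (x (val s)).
exists l => s si.
have El (t : 'I_n.+1) : (i < t)%N -> E l t = x t - D' t (D t (x t)).
  by rewrite /= /dsum_pair; case: {-}_ / idP.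
suff Gx k (t : 'I_n.+1) : (i < t)%N -> (n.+1 <= t + k)%N -> G k l t = x t.
  by apply: Gx => //; rewrite leq_addl.
(* At [k = 0] the bound contradicts [t < n.+1]; in the inductive step [N] reads only coordinates
   beyond [t], where the bound for [k] holds. *)
elim: k t => [|k IH] t ti; first by rewrite addn0 leqNgt ltn_ord.
rewrite addnS => tk.
have -> : G k.+1 l t = E l t - N (G k l) t by [].
rewrite El// NE (eq_bigr (fun j : 'I_n.+1 => A t j (x j))) => [|j tj].
  by rewrite xN// linearN opprK addrK.
by rewrite IH ?(ltn_trans ti)// (leq_trans tk)// -addSn leq_add2r.
Qed.

Lemma tail_kernels_onto (A : forall i j, 'B(X j, X i)) (i : 'I_n.+1)
    (V : closed_subspace (X i)) :
  right_invertible (triangular_op D A) ->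
  (forall s : 'I_n.+1, (i < s)%N -> regular (D s)) ->
  topological_complement (closure (range (D i))) V ->
  exists T : 'B(tail_kernels i, V), forall v, exists l, T l = v.
Proof.
move=> [S TS] Dreg [Q [VQ _ QV Q0]].
have [G GP] := back_substitution A Dreg.
(* The part of row [i] beyond the diagonal, set to zero on the coordinates up to [i], where [G l]
   need not agree with [x]. *)
pose B : 'B(dsum X, X i) :=
  dsum_copair_op (fun j : 'I_n.+1 => if (i < j)%N then A i j else zero_op _ _).
exists (comp_op (corestrict_op VQ) (comp_op B G)) => v.
pose w : X i := \val (v : subspace_type V).
pose x := S (dsum_inj_op i w).
have Tx : triangular_op D A x = dsum_inj_op i w by exact: TS.
have [s si|l lP] := GP x.
  by rewrite Tx dsum_inj_neq//; apply: contraTneq si => ->; rewrite ltnn.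
exists l; apply: val_inj => /=.
rewrite /dsum_copair.
transitivity (Q (\sum_(j < n.+1 | (i < j)%N) A i j (x j))).
  rewrite [in RHS]big_mkcond/=; congr (Q _); apply: eq_bigr => j _.
  by case: ifPn => // /lP ->.
have /(congr1 (fun x : dsum X => x i)) := Tx.
rewrite triangular_opE dsum_injE => /(congr1 Q).
rewrite linearD Q0 ?add0r => [->|]; last by apply: subset_closure; exists (x i).
exact/QV/subspace_valP.
Qed.

End triangular_operators.

(** * Orthogonal projections *)

Lemma closure_normP (K : numFieldType) (V : normedModType K)
    (S : set V) (p : V) :
  closure S p <-> forall e : K, 0 < e -> exists2 s, S s & `|p - s| < e.
Proof.
split=> [Sp e e0|Sp B /nbhs_ballP[e /= e0 eB]].
  by have [s [Ss]] := Sp _ (nbhsx_ballx p e e0); rewrite -ball_normE; exists s.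
have [s Ss ps] := Sp e e0; exists s; split=> //.
by apply: eB; rewrite -ball_normE.
Qed.

Section closure_of_subspace.
Context {K : numFieldType} {X : completeNormedModType K}.
Variable S : set X.
Hypotheses (S0 : S 0) (Slin : forall (a : K) x y, S x -> S y -> S (a *: x + y)).

Lemma closure_subspace_lin (a : K) x y :
  closure S x -> closure S y -> closure S (a *: x + y).
Proof.
move=> /closure_normP Sx /closure_normP Sy; apply/closure_normP => e e0.
(* Dividing by [|a| + 1] rather than [|a|] covers [a = 0]. *)
have a1 : 0 < `|a| + 1 by rewrite ltr_wpDl.
have e2 : 0 < e / 2 by rewrite divr_gt0.
have [s Ss xs] := Sx (e / 2 / (`|a| + 1)) (divr_gt0 e2 a1).
have [t St yt] := Sy (e / 2) e2.
exists (a *: s + t); first exact: Slin.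
rewrite opprD addrACA -scalerBr [ltRHS]splitr.
rewrite (le_lt_trans (ler_normD _ _))// ltr_leD ?(ltW yt)//.
rewrite normrZ (le_lt_trans _ (_ : (`|a| + 1) * `|x - s| < _))//.
  by rewrite ler_wpM2r// lerDl.
by rewrite mulrC -ltr_pdivlMr.
Qed.

Definition closure_subspace : closed_subspace X :=
  ClosedSubspace (@closed_closure _ S) (subset_closure S0) closure_subspace_lin.

End closure_of_subspace.

Section orthogonal_projection.
Context {R : realType} {X : completeNormedModType R[i]}.
Variable ip : {dot X for Num.conj}.
Hypothesis ipE : forall x : X, `|x| ^+ 2 = ip x x.
Variable U : closed_subspace X.

Lemma parallelogram (a b : X) :
  `|a + b| ^+ 2 + `|a - b| ^+ 2 = 2 * (`|a| ^+ 2 + `|b| ^+ 2).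
Proof.
by rewrite !ipE linearBl !linearBr linearDl !linearDr/=; ring.
Qed.

Lemma subspaceD x y : carrier U x -> carrier U y -> carrier U (x + y).
Proof. by move=> Ux Uy; rewrite -[x]scale1r; exact: carrier_lin. Qed.

Lemma subspaceZ (a : R[i]) x : carrier U x -> carrier U (a *: x).
Proof.
by move=> Ux; rewrite -[_ *: _]addr0; apply: carrier_lin => //; exact: carrier0.
Qed.

Lemma subspaceB x y : carrier U x -> carrier U y -> carrier U (x - y).
Proof. by move=> Ux Uy; rewrite -scaleN1r; apply/subspaceD/subspaceZ. Qed.

(** Near-minimisers of the distance form a Cauchy filter by the parallelogram law; its limit lies in
    [U] and attains the distance. *)
Lemma nearest_point x :
  exists2 l, carrier U l & forall u, carrier U u -> `|x - l| <= `|x - u|.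
Proof.
(* The norm takes values in [R[i]]; [q] is its square as an element of [R], where infima are
   available. *)
have [q qE] : exists q : X -> R, forall y, (q y)%:C%C = `|y| ^+ 2.
  exists (fun y => complex.Re (`|y| ^+ 2)) => y.
  by rewrite RRe_real// realX.
have natC k : (k%:R : R)%:C%C = k%:R := rmorph_nat (real_complex R) k.
have q_ge0 y : 0 <= q y by rewrite -lecR qE rmorph0 exprn_ge0.
pose E := [set q (x - u) | u in carrier U]; pose d := inf E.
have E0 : has_inf E.
  split; first by exists (q (x - 0)), 0 => //; exact: carrier0.
  by exists 0 => _ [u _ <-].
have dE u : carrier U u -> d <= q (x - u).
  by move=> Uu; apply: ge_inf E0.2 _ _; exists u.
pose B e := [set u | carrier U u /\ q (x - u) < d + e].
have B0 e : 0 < e -> B e !=set0.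
  by move=> e0; have [_ [u Uu <-] ?] := inf_adherent e0 E0; exists u.
pose F := filter_from [set e : R | 0 < e] B.
have FF : ProperFilter F.
  apply: filter_from_proper => [|e /= /B0//].
  apply: filter_from_filter; first by exists 1 => /=.
  move=> a b /= a0 b0; exists (Num.min a b) => /=; first by rewrite lt_min a0.
  by move=> u [Uu]; rewrite addr_minr lt_min => /andP[ua ub]; split; split.
(* The midpoint of [u] and [v] lies in [U], at squared distance at least [d] from [x], so the
   parallelogram law gives [q (u - v) < 4 (d + e) - 4 d]. *)
have BB e u v : B e u -> B e v -> q (u - v) < 4 * e.
  move=> [Uu ue] [Uv ve].
  have /dE : carrier U (2^-1 *: (u + v)) by apply/subspaceZ/subspaceD.
  have -> : x - 2^-1 *: (u + v) = 2^-1 *: ((x - u) + (x - v)).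
    rewrite addrACA -opprD scalerBr; congr (_ - _).
    by rewrite -mulr2n -[x *+ 2]scaler_nat scalerA mulVf ?scale1r// pnatr_eq0.
  have -> : q (2^-1 *: (x - u + (x - v))) = q (x - u + (x - v)) / 4.
    apply: complexI; rewrite rmorphM/= !qE normrZ exprMn mulrC; congr (_ * _).
    by rewrite [RHS]fmorphV/= (natC 4%N) normfV normr_nat exprVn -natrX.
  have : q (x - u + (x - v)) + q (u - v) = 2 * (q (x - u) + q (x - v)).
    apply: complexI; rewrite rmorphD [RHS]rmorphM [X in _ * X]rmorphD /=.
    rewrite !qE (natC 2%N).
    rewrite -parallelogram; congr (_ + _); rewrite -normrN; congr (`|_| ^+ 2).
    by rewrite opprB opprB addrACA addrC addrA subrK addrC.
  by move=> par du; lra.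
have : cvg F.
  apply: cauchy_cvg; apply: cauchy_exP => e e0.
  have eE : (complex.Re e)%:C%C = e by rewrite RRe_real// gtr0_real.
  have r0 : 0 < complex.Re e by rewrite -ltcR eE.
  have s0 : 0 < complex.Re e ^+ 2 / 4 by rewrite divr_gt0// exprn_gt0.
  have [u Bu] := B0 _ s0; exists u, (complex.Re e ^+ 2 / 4) => //= v Bv.
  rewrite -ball_normE /= -ltr_sqr ?nnegrE ?(ltW e0)// -qE.
  rewrite -eE -rmorphXn/= ltcR (lt_le_trans (BB _ _ _ Bu Bv))//.
  by rewrite mulrC divfK// pnatr_eq0.
move=> /cvg_ex[/= l Fl].
have Ul : carrier U l.
  refine (@closed_cvg _ _ F _ id (carrier U) (@carrier_closed _ _ U) _ l Fl).
  by exists 1 => //= u [].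
exists l => // u Uu; rewrite real_leNgt//; apply/negP => ulx.
(* [e] is such that [d + e <= (|x - u| + g)^2]. A point [v] of [B e] within [g] of [l] then gives
   [|x - l| < |x - u| + 2 g = |x - l|]. *)
pose g := (`|x - l| - `|x - u|) / 2.
have g0 : 0 < g by rewrite divr_gt0// subr_gt0.
pose e := complex.Re ((`|x - u| + g) ^+ 2 - `|x - u| ^+ 2).
have eE : e%:C%C = (`|x - u| + g) ^+ 2 - `|x - u| ^+ 2.
  by apply: RRe_real; rewrite realB ?realX ?realD ?normr_real ?gtr0_real.
have e0 : 0 < e.
  by rewrite -ltcR eE subr_gt0 ltr_sqr ?nnegrE ?ltrDl// addr_ge0// ltW.
have FB : F (B e) by exists e.
have Fl_ball : F (ball l g) by apply: Fl; exact: nbhsx_ballx.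
have [v [[Uv ve]]] := filter_ex (filterI FB Fl_ball).
rewrite -ball_normE /= => lv.
have xv : `|x - v| < `|x - u| + g.
  rewrite -ltr_sqr ?nnegrE//; last by rewrite addr_ge0// ltW.
  rewrite -qE -[ltRHS](subrK (`|x - u| ^+ 2)) -eE -qE -rmorphD ltcR.
  by rewrite (lt_le_trans ve)// addrC lerD2l dE.
have : `|x - l| < `|x - u| + g + g.
  rewrite -(subrK v x) -addrA (le_lt_trans (ler_normD _ _))// subrK ltrD//.
  by rewrite distrC.
by rewrite -addrA -splitr addrC subrK ltxx.
Qed.

(** The coefficient [t = ip w v / ip v v] gives [|w - t v|^2 = |w|^2 - |ip w v|^2 / ip v v], so
    minimality forces [ip w v = 0]. *)
Lemma nearest_orthogonal (w v : X) :
  (forall t : R[i], `|w| <= `|w - t *: v|) -> ip w v = 0.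
Proof.
move=> wmin; have [->|v0] := eqVneq v 0; first exact: linear0r.
have vv0 : 0 < ip v v by rewrite dnorm_gt0.
have /= := wmin (ip w v / ip v v).
set h := ip w v; set c := ip v v in vv0 *.
have c_real : c^* = c by exact/CrealP/gtr0_real.
have dE : (h / c)^* * h = `|h| ^+ 2 / c.
  by rewrite rmorphM/= fmorphV/= c_real mulrAC -normCKC.
have nE : `|h / c| ^+ 2 * c = `|h| ^+ 2 / c.
  rewrite normrM normfV (gtr0_norm vv0) exprMn -mulrA; congr (_ * _).
  by rewrite expr2 mulfVK// gt_eqF.
rewrite -ler_sqr ?nnegrE// !ipE dnormB dnormZ linearZr_LR/= -/h -/c dE nE.
rewrite [X in _ - (_ + X)]rmorphM/= fmorphV/= c_real rmorphXn/= conj_normC.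
rewrite opprD addrA addrK lerDl oppr_ge0 pmulr_lle0 ?invr_gt0//.
by move=> h0; apply/normr0_eq0/eqP; rewrite -sqrf_eq0 eq_le h0 exprn_ge0.
Qed.

(** Orthogonality of [x - p x] to [U] determines [p x], whence the nearest-point map [p] is linear;
    Pythagoras bounds its norm by 1. *)
Lemma orthogonal_complemented : complemented (carrier U).
Proof.
have /choice[p pP] x :
    exists l, carrier U l /\ forall u, carrier U u -> ip (x - l) u = 0.
  have [l Ul lmin] := nearest_point x; exists l; split=> // u Uu.
  apply: nearest_orthogonal => t; rewrite -addrA -opprD.
  by apply/lmin/subspaceD/subspaceZ.
have p_uniq x l : carrier U l ->
    (forall u, carrier U u -> ip (x - l) u = 0) -> p x = l.
  move=> Ul lP; have [Up pxP] := pP x.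
  apply/eqP; rewrite -subr_eq0 -(dnorm_eq0 ip).
  (* Both terms of this difference are orthogonal to [U], which contains [p x - l]; this vector is
     thus orthogonal to itself. *)
  have {1}-> : p x - l = (x - l) - (x - p x).
    by rewrite opprB [RHS]addrC addrA subrK.
  by rewrite linearBl/= lP ?pxP ?subrr//; exact: subspaceB.
have plin : linear p.
  move=> a x y; have [[Ux xP] [Uy yP]] := (pP x, pP y).
  apply: p_uniq => [|u Uu]; first exact: carrier_lin.
  by rewrite opprD addrACA -scalerBr linearPl/= xP// yP// mulr0 addr0.
have pbnd : exists M : R[i], forall x, `|p x| <= M * `|x|.
  exists 1 => x; rewrite mul1r -ler_sqr ?nnegrE// !ipE.
  rewrite -[x in leRHS](subrK (p x)).
  have [Up xP] := pP x.
  by rewrite hnormDd; [rewrite lerDr dnorm_ge0 | exact: xP].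
pose pL := GRing.isLinear.Build R[i] X X _ p plin.
pose P0 : {linear X -> X} := HB.pack p pL.
pose P : 'B(X, X) := @BoundedOp _ _ _ P0 pbnd.
have Pp x : P x = p x by [].
have pU u : carrier U u -> p u = u.
  by move=> Uu; apply: p_uniq => // v _; rewrite subrr linear0l.
exists (nullspace P), (sub_op (id_op X) P); split=> x /=.
- by rewrite -!Pp linearB !Pp (pU (p x)) ?subrr//; exact: (pP x).1.
- by rewrite subKr; exact: (pP x).1.
- by move=> ->; rewrite subr0.
- by move=> /pU ->; rewrite subrr.
Qed.

End orthogonal_projection.

Lemma hilbert_complemented (R : realType) (X : completeNormedModType R[i])
    (U : closed_subspace X) : hilbert X -> complemented (carrier U).
Proof. by move=> [ip ipE]; exact: orthogonal_complemented ipE U. Qed.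

(** * Derivation of (i) => (ii) and of (ii) => (iii) *)

Theorem theorem2p8 (R : realType) (n : nat)
    (X : 'I_n.+2 -> completeNormedModType R[i])
    (D : forall i, 'B(X i, X i))
    (K : forall i, closed_subspace (X i))
    (KP : forall i, complemented (closure (range (D i))) ->
      topological_complement (closure (range (D i))) (K i))
    (D_reg : forall s : 'I_n.+2, (0 < s < n.+1)%N -> regular (D s)) :
  let cond_i :=
    right_invertible (D ord_max) /\
    (regular (D ord0) /\
     forall i j : 'I_n.+2, j = i.+1 :> nat -> preceq (K i) (nullspace (D j))) in
  let cond_ii :=
    exists A : forall i j : 'I_n.+2, 'B(X j, X i),
      right_invertible (triangular_op D A) in
  let cond_iii :=
    right_invertible (D ord_max) /\
    forall i : 'I_n.+2, (i < n.+1)%N ->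
      ~ prec (dsum (fun s : {s : 'I_n.+2 | (i < s)%N} => nullspace (D (val s))))
             (K i) in
  (cond_i -> cond_ii) /\
  ((forall i, infinite_dim (X i) /\ hilbert (X i)) -> cond_ii -> cond_iii).
Proof.
(* With indices from zero, [D_reg] covers the middle entries, and the last one is regular because it
   is right invertible. *)
have Dreg (s : 'I_n.+2) :
    right_invertible (D ord_max) -> (0 < s)%N -> regular (D s).
  move=> Dn s0; have [->|sn] := eqVneq s ord_max.
    exact: right_invertible_regular.
  apply: D_reg; rewrite s0 ltn_neqAle -ltnS ltn_ord andbT.
  by apply: contra sn => /eqP sn; exact/eqP/val_inj.
move=> cond_i cond_ii cond_iii; split=> [[Dn [D0 KN]]|hilb [A TA]].
  have {}Dreg s : regular (D s).
    have [s0|/(Dreg s Dn)//] := posnP s.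
    by rewrite (_ : s = ord0)//; exact: val_inj.
  have [D' DD'] := all_sig (fun s => cid (Dreg s)).
  have [Q QP] := all_sig (fun i => cid (KP i (regular_complemented (Dreg i)))).
  (* The complement only places [y - Q i y] in the closure of the range, which is the range itself
     by regularity. *)
  have QD i y : range (D i) (y - Q i y).
    rewrite (proj1 (closure_id _) (regular_closed_range (Dreg i))).
    by have [_ + _ _] := QP i; apply.
  (* [D ord_max] is onto, so the projection [Q ord_max] along its range vanishes. *)
  apply: (superdiagonal_right_invertible (D' := D') (Q := Q)) => // [y|i j ji].
    have [_ _ _] := QP ord_max; apply; apply: subset_closure.
    by have [S DS] := Dn; exists (S y).
  have [KQ _ _ _] := QP i.
  exact: kernel_transfer (DD' j) KQ (KN i j ji).
have Dn := triangular_last_right_invertible TA.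
split=> // i ilt [_]; have [T Tonto] : exists T : 'B(
    dsum (fun s : {s : 'I_n.+2 | (i < s)%N} => nullspace (D (val s))), K i),
    forall v, exists l, T l = v.
  apply: tail_kernels_onto TA _ (KP i _) => [s si|].
    exact/Dreg/(leq_ltn_trans _ si).
  have [i0|i0] := posnP i; last first.
    by apply/regular_complemented/Dreg.
  have r0 : range (D i) 0 by exists 0 => //; exact: linear0.
  have rlin (a : R[i]) x y :
      range (D i) x -> range (D i) y -> range (D i) (a *: x + y).
    by move=> [u _ <-] [v _ <-]; exists (a *: u + v) => //; exact: linearP.
  exact: hilbert_complemented (closure_subspace r0 rlin) (hilb i).2.
(* The quotient by the range of the surjective [T] is zero, hence spanned by the empty list. *)
move/(_ T); apply; exists [::] => v; exists v.
  by have [l <-] := Tonto v; exists l.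
by exists (fun=> 0); rewrite big_ord0 addr0.
Qed.
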